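(* Let $m,c$ be fixed positive integers, and let $T_n$ denote the number of $(c,m)$-colored $B_n$-partitions. For each $n\ge1$ let $r=r(n)$ be the unique positive solution of $r\,(e^{mr}+c)=n$. Then, as $n\to\infty$, \[ T_n=\frac{1}{\sqrt{mr+1}}\exp\Bigl(mnr-n+\frac{n}{mr}+2cr-\frac{1+c}{m}\Bigr)\cdot\Bigl(1+O\Bigl(\frac{\log^{7/2} n}{\sqrt n}\Bigr)\Bigr). \]
   Context: Let $n,m,c$ be positive integers, let $C_1$ be a list of $c$ colors and $C_2$ a list of $m$ colors. A $(c,m)$-colored $B_n$-partition is a set partition $\pi$ of $[n]\cup\{0\}$ together with a coloring of the elements of $[n]$ defined as follows. For $x\in[n]\cup\{0\}$ let $b_x$ be the block of $\pi$ containing $x$. The block $b_0$ is called the zero-block, and every other block is a non-zero-block. Each $x\in[n]$ receives a color according to these rules: if $x=\min b_x$, then $x$ gets the first color of $C_2$; if $x\ne\min b_x$ and $x\in b_0$, then $x$ gets an arbitrary color from $C_1$; if $x\ne \min b_x$ and $x\notin b_0$, then $x$ gets an arbitrary color from $C_2$. Two such objects are equal exactly when they have the same underlying partition and the same coloring. Equivalently, $\sum_{n\ge0}T_n z^n/n!=\exp\bigl((e^{mz}-1)/m+cz\bigr)$ with $T_0=1$. *)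

(* Defs.v *)
From mathcomp Require Import all_boot.
From Stdlib Require Import Reals.

Set Implicit Arguments.
Unset Strict Implicit.
Unset Printing Implicit Defensive.

(* Ground set [n] ∪ {0} is 'I_n.+1 (element 0 is ord0).
   Colors: C1 = 'I_c (used via inl), C2 = 'I_m (used via inr);
   the "first color of C2" is the one with index 0. *)

Definition is_block_min n (P : {set {set 'I_n.+1}}) (x : 'I_n.+1) : bool :=
  [forall y in pblock P x, (x <= y)%N].

(* The coloring rules.  They are imposed on every x : 'I_n.+1; for x = 0
   (which is always the minimum of the zero-block) this just forces the
   dummy value "first color of C2", so it does not affect the count. *)
Definition valid_coloring c m n (P : {set {set 'I_n.+1}})
    (f : {ffun 'I_n.+1 -> 'I_c + 'I_m}) : bool :=
  [forall x : 'I_n.+1,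
     if is_block_min P x then
       (if f x is inr j then (nat_of_ord j == 0)%N else false)
     else if x \in pblock P ord0 then
       (if f x is inl _ then true else false)
     else
       (if f x is inr _ then true else false)].

Definition colored_Bpartitions c m n :=
  [set pf : {set {set 'I_n.+1}} * {ffun 'I_n.+1 -> 'I_c + 'I_m} |
     partition pf.1 [set: 'I_n.+1] && valid_coloring pf.1 pf.2].

Definition T (c m n : nat) : nat := #|colored_Bpartitions c m n|.

(* Main.v *)
(* By Dobinski's formula, [T_n] is the mean of [(m K + c)^n] for [K] Poisson of
   parameter [1/m]. Tilting to the Poisson law of parameter [lam = e^(m r) / m]
   extracts the exponential factor and leaves the mean of [exp (- n h x)], where
   [h x = x - ln (1 + x)] and [x = (m r / n) (K - lam)]: by the choice of [r] the
   linear terms cancel. A third moment bound replaces [h x] by [x^2 / 2]. The mean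
   [phi t] of [exp (- t^2 (K - lam)^2)] is compared with its Gaussian value
   [1 / sqrt (1 + 2 lam t^2)] by the Chen-Stein identity, which says that
   [phi t * sqrt (1 + 2 lam t^2)] has a small derivative. *)

Require Import Defs.
From Stdlib Require Import Reals Lra Psatz.
From Coquelicot Require Import Coquelicot.
From mathcomp Require Import all_boot.

Set Implicit Arguments.
Unset Strict Implicit.
Unset Printing Implicit Defensive.

(** * Colored partitions as weighted partitions *)

Local Open Scope nat_scope.

(** No generating function enters: the weighted count of partitions and the Poisson moments satisfy
    the same recursion, obtained by removing the block of one element. The obstacle in the Gaussian
    step is the tail of the Poisson law. It is never cut off: the exponentials compared lie in
    (0,1], the error bounds are polynomial in [k - lam] and hold for every [k], so central moments
    up to order four suffice. The exponent 7/2 comes from the third moment. With [b = m r / n] and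
    [lam <= n], the error [n b^3 lam^(3/2)] is at most [(m r)^3 / sqrt n]; the normalizing root, of
    order [sqrt (m r)], multiplies it, and [m r <= ln n]. Every other error is at most of order
    [ln^2 n / sqrt n]. *)

Lemma sum_subset_expn (U : finType) (A : {set U}) (x y : nat) :
  \sum_(B : {set U} | B \subset A) x ^ #|B| * y ^ #|A :\: B| = (x + y) ^ #|A|.
Proof.
(* The product is padded to all of [U]: outside [A] the 0 kills each subset not contained in [A],
   and the 1 leaves the others unchanged. *)
transitivity (\prod_i ((if i \in A then x else 0) + (if i \in A then y else 1))).
  rewrite bigA_distr /= big_mkcond /=; apply: eq_bigr => B _.
  case: ifP => [sBA|/subsetPn[i iB iNA]]; last first.
    by rewrite (bigD1 i) //= iB (negbTE iNA) mul0n.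
  rewrite (bigID [in B]) /= -!prod_nat_const; congr (_ * _).
    by apply: eq_bigr => i iB; rewrite iB (subsetP sBA).
  rewrite [in RHS](bigID [in A]) /= [X in _ = _ * X]big1 ?muln1; last first.
    by move=> i /andP[/negbTE-> /negbTE->].
  apply: eq_big => [i|i]; first by rewrite inE.
  by rewrite inE => /andP[/negbTE-> ->].
rewrite -prod_nat_const [RHS]big_mkcond /=; apply: eq_bigr => i _.
by case: ifP.
Qed.

Definition partition_weight (U : finType) (v : {set U} -> nat) (A : {set U}) :=
  \sum_(P : {set {set U}} | partition P A) \prod_(B in P) v B.

Lemma partition_weight0 (U : finType) (v : {set U} -> nat) :
  partition_weight v set0 = 1.
Proof.
rewrite /partition_weight (eq_bigl (pred1 set0)); last first.
  by move=> P; rewrite partition_set0.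
by rewrite big_pred1_eq big_set0.
Qed.

(** Partitions are sorted by the block of [a], written [a |: B]; deleting this block is a bijection
    onto the partitions of what remains. *)
Lemma partition_weight_rec (U : finType) (v : {set U} -> nat) (A : {set U}) a :
  a \in A ->
  partition_weight v A =
  \sum_(B : {set U} | B \subset A :\ a)
     v (a |: B) * partition_weight v ((A :\ a) :\: B).
Proof.
move=> aA; rewrite /partition_weight.
rewrite (partition_big (fun P => pblock P a :\ a) (fun B => B \subset A :\ a)) /=;
  last first.
  move=> P PA; rewrite setSD // -(cover_partition PA).
  by apply/subsetP => x xp; apply/bigcupP; exists (pblock P a); rewrite ?pblock_mem ?(cover_partition PA).
apply: eq_bigr => B sBA.
have aB : a \notin B by apply: contraTN sBA => aB; apply/subsetPn; exists a; rewrite ?inE ?eqxx.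
have sBA' : a |: B \subset A.
  by rewrite subUset sub1set aA (subset_trans sBA) ?subsetDl.
have AD : A = (a |: B) :|: (A :\ a :\: B).
  apply/setP=> x; rewrite !inE; case: eqVneq => [->|] //=.
  case xB: (x \in B) => //=; by rewrite (subsetP sBA') // !inE xB orbT.
have AD' : A :\: (a |: B) = A :\ a :\: B by rewrite setDDl.
rewrite big_distrr /= (reindex_onto (fun Q => (a |: B) |: Q) (fun P => P :\ (a |: B))) /=.
  apply: eq_big => [Q|Q /andP[/andP[PA /eqP pB] /eqP QE]].
    apply/idP/idP.
      case/andP => /andP[PA _] /eqP QE; rewrite -QE -AD'.
      by apply: partitionD1 PA _; rewrite !inE eqxx.
    move=> QD.
    have NQ : a |: B \notin Q.
      apply/negP => BQ.
      have: a \in cover Q by apply/bigcupP; exists (a |: B) => //; rewrite !inE eqxx.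
      by rewrite (cover_partition QD) !inE eqxx andbF.
    have PA : partition ((a |: B) |: Q) A.
      rewrite [X in partition _ X]AD; apply: partitionU1 => //.
        by apply/set0Pn; exists a; rewrite !inE eqxx.
      rewrite -setI_eq0 -AD'; apply/eqP/setP => x; rewrite !inE.
      by case: (_ || _).
    rewrite PA setU1K // eqxx andbT /=.
    case/and3P: PA => _ tI _.
    rewrite (def_pblock (B := a |: B) tI) ?setU1K // !inE eqxx //.
  by rewrite big_setU1 //= -QE !inE eqxx.
move=> P /andP[PA /eqP pB]; rewrite setD1K // -pB setD1K.
  by rewrite pblock_mem // (cover_partition PA).
by rewrite mem_pblock (cover_partition PA).
Qed.

(** The number of colorings of one block: the minimum has a forced color, whence the predecessor in
    the exponent. In the zero-block that minimum is 0 itself. *)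
Definition block_weight (c m n : nat) (B : {set 'I_n.+1}) :=
  (if ord0 \in B then c else m) ^ #|B|.-1.

Lemma prod_block (c m n : nat) (P : {set {set 'I_n.+1}}) (B : {set 'I_n.+1}) :
  partition P [set: 'I_n.+1] -> B \in P ->
  \prod_(x in B) (if is_block_min P x then 1
                  else if x \in pblock P ord0 then c else m)
  = block_weight c m B.
Proof.
move=> PT BP; have [cT tI /negP P0] := and3P PT.
have [y0 y0B] : exists x, x \in B.
  by apply/set0Pn; apply/negP => /eqP B0; apply: P0; rewrite -B0.
case: (arg_minnP (P := [in B]) (fun x : 'I_n.+1 => x : nat) y0B) => x0 x0B x0min.
have minE x : x \in B -> is_block_min P x = (x == x0).
  move=> xB; rewrite /is_block_min (def_pblock tI BP xB).
  apply/forall_inP/eqP => [h|-> y yB]; last exact: x0min.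
  by apply/val_inj/eqP; rewrite eqn_leq h //= x0min.
rewrite (bigD1 x0) //= minE // eqxx mul1n /block_weight.
have -> : #|B|.-1 = #|B :\ x0| by rewrite (cardsD1 x0 B) x0B.
rewrite -prod_nat_const; apply: eq_big => [x|x /andP[xB /negbTE nx]].
  by rewrite !inE andbC.
rewrite minE // nx.
have -> : (x \in pblock P ord0) = (ord0 \in B) => //.
have cov : cover P = [set: 'I_n.+1] by apply/eqP.
apply/idP/idP => [xp|oB]; last by rewrite (def_pblock tI BP oB).
rewrite -(def_pblock tI BP xB) (same_pblock tI xp) mem_pblock cov inE //.
Qed.

(** The rule at a point depends on [P] only, not on the other colors, so the valid colorings form a
    product [family]. *)
Lemma card_valid_coloring (c m n : nat) (P : {set {set 'I_n.+1}}) :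
  0 < m ->
  #|[set f | valid_coloring (c := c) (m := m) P f]| =
  \prod_(x : 'I_n.+1) (if is_block_min P x then 1
                  else if x \in pblock P ord0 then c else m).
Proof.
move=> m0.
pose F (x : 'I_n.+1) : pred ('I_c + 'I_m) := fun s =>
  if is_block_min P x then (if s is inr j then (nat_of_ord j == 0)%N else false)
  else if x \in pblock P ord0 then (if s is inl _ then true else false)
  else (if s is inr _ then true else false).
have -> : #|[set f | valid_coloring (c := c) (m := m) P f]| = #|(family F : pred {ffun 'I_n.+1 -> 'I_c + 'I_m})|.
  by apply: eq_card => f; rewrite inE; apply/forallP/familyP.
rewrite card_family foldrE big_image /=.
apply: eq_bigr => x _; rewrite /F.
case: (is_block_min P x).
  rewrite -(card1 (inr (Ordinal m0) : 'I_c + 'I_m)); apply: eq_card => -[i|j] //.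
case: (x \in _).
  rewrite -[RHS]card_ord -(card_image (f := (@inl 'I_c 'I_m))) => [|? ? []//].
  by apply: eq_card => -[i|j]; apply/esym; [apply/imageP; exists i|apply/negP => /imageP[]].
rewrite -[RHS]card_ord -(card_image (f := (@inr 'I_c 'I_m))) => [|? ? []//].
by apply: eq_card => -[i|j]; apply/esym; [apply/negP => /imageP[]|apply/imageP; exists j].
Qed.

Lemma T_partition_weight (c m n : nat) : 0 < m ->
  T c m n = partition_weight (@block_weight c m n) [set: 'I_n.+1].
Proof.
move=> m0; rewrite /T /partition_weight -sum1_card.
rewrite (eq_bigl (fun pf : {set {set 'I_n.+1}} * {ffun 'I_n.+1 -> 'I_c + 'I_m} =>
     partition pf.1 [set: 'I_n.+1] && valid_coloring pf.1 pf.2)); last by move=> pf; rewrite inE.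
rewrite -(pair_big_dep (fun P => partition P [set: 'I_n.+1]) (fun P f => valid_coloring P f) (fun _ _ => 1)) /=.
apply: eq_bigr => P PT.
have -> : \sum_(f | valid_coloring (c := c) (m := m) P f) 1 = #|[set f | valid_coloring (c := c) (m := m) P f]|.
  by rewrite -sum1_card; apply: eq_bigl => f; rewrite inE.
rewrite card_valid_coloring //.
under [RHS]eq_bigr => B BP do rewrite -(prod_block c m PT BP).
rewrite -(set_partition_big P PT).
by apply: eq_bigl => x; rewrite inE.
Qed.

Local Open Scope R_scope.

(** * Dobinski's formula *)

Lemma INR_expn (a k : nat) : INR (a ^ k)%N = INR a ^ k.
Proof. by elim: k => //= k IH; rewrite expnS mult_INR IH. Qed.

(** The mean of [f] under the Poisson law is [a], with the factor [exp (- lam)] cleared. As a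
    relation it carries convergence along, and the natural-number [a] can be matched directly with a
    count. *)
Definition poisson_mean (lam : R) (f : nat -> nat) (a : nat) :=
  is_series (fun k => lam ^ k / INR (Factorial.fact k) * INR (f k))
    (INR a * exp lam).

Lemma poisson_mean_ext lam f g a b :
  f =1 g -> a = b -> poisson_mean lam f a -> poisson_mean lam g b.
Proof. by move=> fg <-; apply: is_series_ext => k; rewrite fg. Qed.

Lemma poisson_mean_one lam : poisson_mean lam (fun=> 1%N) 1.
Proof.
rewrite /poisson_mean Rmult_1_l; apply: is_series_ext (is_exp_Reals lam) => k.
by rewrite pow_n_pow /scal /= /mult /= /Rdiv Rmult_1_r.
Qed.

Lemma poisson_mean_zero lam : poisson_mean lam (fun=> 0%N) 0.
Proof.
rewrite /poisson_mean Rmult_0_l.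
apply: (is_series_ext (fun=> 0)) => [k|]; first by rewrite Rmult_0_r.
have := is_series_scal 0 _ _ (@poisson_mean_one lam).
rewrite /scal /= /mult /= Rmult_0_l.
by apply: is_series_ext => k; rewrite Rmult_0_l.
Qed.

Lemma poisson_mean_add lam f g a b :
  poisson_mean lam f a -> poisson_mean lam g b ->
  poisson_mean lam (fun x => f x + g x)%N (a + b)%N.
Proof.
rewrite /poisson_mean => fa gb; rewrite plus_INR Rmult_plus_distr_r.
apply: is_series_ext (is_series_plus _ _ _ _ fa gb) => k.
by rewrite /plus /= plus_INR; ring.
Qed.

Lemma poisson_mean_scal lam (d : nat) f a :
  poisson_mean lam f a -> poisson_mean lam (fun x => d * f x)%N (d * a)%N.
Proof.
rewrite /poisson_mean => fa; rewrite mult_INR Rmult_assoc.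
apply: is_series_ext (is_series_scal (INR d) _ _ fa) => k.
by rewrite /scal /= /mult /= mult_INR; ring.
Qed.

Lemma poisson_mean_sum lam (I : finType) (p : pred I) (f : I -> nat -> nat) a :
  (forall i, p i -> poisson_mean lam (f i) (a i)) ->
  poisson_mean lam (fun x => \sum_(i | p i) f i x)%N (\sum_(i | p i) a i)%N.
Proof.
move=> H; elim: (index_enum I) => [|i s IH].
  apply: poisson_mean_ext (@poisson_mean_zero lam) => [x|]; by rewrite big_nil.
case pi: (p i).
  apply: poisson_mean_ext (poisson_mean_add (H i pi) IH) => [x|];
  by rewrite big_cons pi.
by apply: poisson_mean_ext IH => [x|]; rewrite big_cons pi.
Qed.

(** The identity [k / k! = 1 / (k-1)!] shifts the index at the cost of a factor [1/m], which the
    factor [m] on the left cancels. *)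
Lemma poisson_mean_shift (m : nat) f a : (0 < m)%N ->
  poisson_mean (/ INR m) (fun x => f x.+1) a ->
  poisson_mean (/ INR m) (fun x => m * x * f x)%N a.
Proof.
move=> m0; have mR : INR m <> 0 by apply: not_0_INR => m00; rewrite m00 in m0.
rewrite /poisson_mean => fa; apply: is_series_decr_1.
rewrite muln0 mul0n Rmult_0_r opp_zero plus_zero_r.
apply: is_series_ext fa => k.
rewrite fact_simpl !mult_INR S_INR /=.
field; split => //; split; first exact: INR_fact_neq_0.
by have := pos_INR k; lra.
Qed.

(** One factor [m x] of the power is traded for the shift [x -> x + 1]. The remaining power becomes
    [(m + m x)^(|A|-1)], whose expansion over subsets [B] is the recursion for the block of [a],
    since that block has weight [m^|B|]. *)
Lemma poisson_mean_partition_weight (m : nat) (U : finType)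
    (v : {set U} -> nat) (A : {set U}) : (0 < m)%N ->
  (forall B : {set U}, B \subset A -> v B = (m ^ #|B|.-1)%N) ->
  poisson_mean (/ INR m) (fun x => (m * x) ^ #|A|)%N (partition_weight v A).
Proof.
move=> m0; move: {2}(#|A|) (leqnn #|A|) => k; elim: k A => [|k IH] A.
  rewrite leqn0 cards_eq0 => /eqP-> _; rewrite partition_weight0 cards0.
  exact: poisson_mean_one.
have [->|[a aA]] := set_0Vmem A.
  by move=> _ _; rewrite partition_weight0 cards0; exact: poisson_mean_one.
rewrite (cardsD1 a A) aA ltnS => Ak vA.
rewrite (partition_weight_rec v aA).
apply: (poisson_mean_ext (f := fun x => m * x * (m * x) ^ #|A :\ a|)%N) => [x||] //.
  by rewrite add1n expnS.
apply: (poisson_mean_shift (f := fun x => (m * x) ^ #|A :\ a|)%N) => //.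
apply: (poisson_mean_ext (f := fun x => \sum_(B : {set U} | B \subset A :\ a) m ^ #|B| * (m * x) ^ #|A :\ a :\: B|)%N) => [x||] //.
  by rewrite sum_subset_expn mulnS.
apply: poisson_mean_sum => B sB.
rewrite vA; last first.
  by rewrite subUset sub1set aA (subset_trans sB) ?subsetDl.
rewrite cardsU1 (_ : a \notin B) ?add1n //=; last first.
  by apply: contraTN sB => aB; apply/subsetPn; exists a; rewrite ?inE ?eqxx.
apply: poisson_mean_scal; apply: IH => [|C sC].
  by apply: leq_trans Ak; rewrite subset_leq_card ?subsetDl.
by apply: vA; rewrite (subset_trans sC) // setDDl subsetDl.
Qed.

(** The zero-block is removed first: its other elements form [B] with weight [c^|B|], the complement
    contributes a power of [m x], and the sum over [B] is binomial. *)
Lemma poisson_mean_T (m c n : nat) : (0 < m)%N ->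
  poisson_mean (/ INR m) (fun x => (m * x + c) ^ n)%N (T c m n).
Proof.
move=> m0; rewrite T_partition_weight //.
rewrite (partition_weight_rec _ (in_setT ord0)).
have card0 : #|[set: 'I_n.+1] :\ ord0| = n.
  by rewrite cardsDS ?subsetT // cardsT card_ord cards1 subn1.
apply: (poisson_mean_ext (f := fun x => \sum_(B : {set 'I_n.+1} | B \subset [set: 'I_n.+1] :\ ord0) c ^ #|B| * (m * x) ^ #|[set: 'I_n.+1] :\ ord0 :\: B|)%N) => [x||] //.
  by rewrite sum_subset_expn card0 addnC.
apply: poisson_mean_sum => B sB.
rewrite /block_weight !inE eqxx /= cardsU1 (_ : ord0 \notin B) ?add1n /=; last first.
  by apply: contraTN sB => aB; apply/subsetPn; exists ord0; rewrite ?inE ?eqxx.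
apply: poisson_mean_scal; apply: poisson_mean_partition_weight => // C sC.
rewrite ifF //; apply/negbTE; apply: contraTN sC => aC.
by apply/subsetPn; exists ord0; rewrite ?inE ?eqxx ?andbF.
Qed.

Lemma dobinski_formula (m c n : nat) : (0 < m)%N ->
  is_series (fun k => (/ INR m) ^ k / INR (Factorial.fact k) * (INR m * INR k + INR c) ^ n)
    (INR (T c m n) * exp (/ INR m)).
Proof.
move=> m0; move: (@poisson_mean_T m c n m0); apply: is_series_ext => k.
by rewrite INR_expn plus_INR mult_INR.
Qed.

(** * Means under the Poisson law *)

(** A growth class on which Poisson series converge absolutely, closed under sums, products and the
    index shift of the Stein identity. *)
Definition exp_bounded (f : nat -> R) :=
  exists C A, forall k, Rabs (f k) <= C * A ^ k.

Lemma exp_bounded_const a : exp_bounded (fun=> a).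
Proof. exists (Rabs a), 1 => k; rewrite pow1; lra. Qed.

Lemma exp_bounded_INR : exp_bounded INR.
Proof.
exists 1, 2 => k; rewrite Rabs_pos_eq; last exact: pos_INR.
elim: k => [|k IH]; first by rewrite /=; lra.
have : 1 <= 2 ^ k by apply: pow_R1_Rle; lra.
by rewrite S_INR /=; lra.
Qed.

Lemma exp_bounded_le f g : (forall k, Rabs (f k) <= Rabs (g k)) ->
  exp_bounded g -> exp_bounded f.
Proof.
move=> fg [C [A H]]; exists C, A => k; exact: Rle_trans (fg k) (H k).
Qed.

Lemma exp_bounded_pos f : exp_bounded f ->
  exists C A, 0 <= C /\ 1 <= A /\ forall k, Rabs (f k) <= C * A ^ k.
Proof.
move=> [C [A H]]; exists (Rabs C), (Rmax 1 (Rabs A)).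
split; first exact: Rabs_pos.
split=> [|k]; first exact: Rmax_l.
apply: Rle_trans (H k) _; apply: Rle_trans (Rle_abs _) _.
rewrite Rabs_mult -RPow_abs; apply: Rmult_le_compat_l; first exact: Rabs_pos.
by apply: pow_incr; split; [exact: Rabs_pos|exact: Rmax_r].
Qed.

Lemma exp_bounded_plus f g : exp_bounded f -> exp_bounded g ->
  exp_bounded (fun k => f k + g k).
Proof.
move=> /exp_bounded_pos[C [A [C0 [A1 H]]]] /exp_bounded_pos[D [B [D0 [B1 G]]]].
exists (C + D), (Rmax A B) => k.
have hA : A ^ k <= Rmax A B ^ k by apply: pow_incr; split; [lra|exact: Rmax_l].
have hB : B ^ k <= Rmax A B ^ k by apply: pow_incr; split; [lra|exact: Rmax_r].
have := Rmult_le_compat_l _ _ _ C0 hA; have := Rmult_le_compat_l _ _ _ D0 hB.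
have := H k; have := G k; have := Rabs_triang (f k) (g k); lra.
Qed.

Lemma exp_bounded_mult f g : exp_bounded f -> exp_bounded g ->
  exp_bounded (fun k => f k * g k).
Proof.
move=> [C [A H]] [D [B G]]; exists (C * D), (A * B) => k.
rewrite Rabs_mult Rpow_mult_distr.
have := Rmult_le_compat _ _ _ _ (Rabs_pos _) (Rabs_pos _) (H k) (G k); lra.
Qed.

Lemma exp_bounded_shift f : exp_bounded f -> exp_bounded (fun k => f k.+1).
Proof.
move=> [C [A H]]; exists (C * A), A => k; have /= := H k.+1; lra.
Qed.

Lemma exp_bounded_bounded C f : (forall k, Rabs (f k) <= C) -> exp_bounded f.
Proof. by move=> H; exists C, 1 => k; rewrite pow1 Rmult_1_r. Qed.

Lemma exp_bounded_opp f : exp_bounded f -> exp_bounded (fun k => - f k).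
Proof. by move=> [C [A H]]; exists C, A => k; rewrite Rabs_Ropp. Qed.

Lemma exp_bounded_abs f : exp_bounded f -> exp_bounded (fun k => Rabs (f k)).
Proof. by move=> [C [A H]]; exists C, A => k; rewrite Rabs_Rabsolu. Qed.

Definition pois (lam : R) (k : nat) := exp (- lam) * (lam ^ k / INR (Factorial.fact k)).

(** [Series] is total, so convergence has to be supplied separately: additivity below asks for
    [exp_bounded], while scaling holds without it. *)
Definition expect (lam : R) (f : nat -> R) := Series (fun k => pois lam k * f k).

Section Expect.
Variable lam : R.
Hypothesis lam0 : 0 < lam.

Lemma pois_ge0 k : 0 <= pois lam k.
Proof.
apply: Rmult_le_pos; first exact/Rlt_le/exp_pos.
apply: Rdiv_le_0_compat; [apply: pow_le; lra|exact: INR_fact_lt_0].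
Qed.

Lemma ex_expect f : exp_bounded f -> ex_series (fun k => pois lam k * f k).
Proof.
move=> [C [A H]].
apply: (@ex_series_le R_AbsRing R_CompleteNormedModule _
  (fun k => exp (- lam) * C * ((lam * A) ^ k / INR (Factorial.fact k)))) => [k|].
  rewrite /norm /= /abs /= Rabs_mult Rabs_pos_eq; last exact: pois_ge0.
  have := Rmult_le_compat_l _ _ _ (pois_ge0 k) (H k).
  rewrite /pois Rpow_mult_distr /Rdiv; lra.
apply: (@ex_series_scal R_AbsRing R_NormedModule).
exists (exp (lam * A)); apply: is_series_ext (is_exp_Reals (lam * A)) => k.
by rewrite pow_n_pow /scal /= /mult /= /Rdiv.
Qed.

Lemma expect_ext f g : (forall k, f k = g k) -> expect lam f = expect lam g.
Proof. by move=> fg; apply: Series_ext => k; rewrite fg. Qed.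

Lemma expect_one : expect lam (fun=> 1) = 1.
Proof.
apply: is_series_unique; rewrite -[X in is_series _ X](_ : exp (-lam) * exp lam = 1).
  apply: is_series_ext (@is_series_scal _ R_NormedModule (exp (-lam)) _ _ (is_exp_Reals lam)) => k.
  by rewrite pow_n_pow /scal /= /mult /= /pois /Rdiv; ring.
by rewrite -exp_plus Rplus_opp_l exp_0.
Qed.

Lemma expect_plus f g : exp_bounded f -> exp_bounded g ->
  expect lam (fun k => f k + g k) = expect lam f + expect lam g.
Proof.
move=> F G; rewrite /expect -Series_plus; try exact: ex_expect.
by apply: Series_ext => k; ring.
Qed.

Lemma expect_scal a f : expect lam (fun k => a * f k) = a * expect lam f.
Proof. by rewrite /expect -Series_scal_l; apply: Series_ext => k; ring. Qed.

Lemma expect_const a : expect lam (fun=> a) = a.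
Proof.
by rewrite -{2}(Rmult_1_r a) -expect_one -expect_scal; apply: expect_ext => k; ring.
Qed.


Lemma expect_minus f g : exp_bounded f -> exp_bounded g ->
  expect lam (fun k => f k - g k) = expect lam f - expect lam g.
Proof.
move=> F G; rewrite /expect -Series_minus; try exact: ex_expect.
by apply: Series_ext => k; ring.
Qed.

Lemma expect_abs_le f g : exp_bounded g -> (forall k, Rabs (f k) <= g k) ->
  Rabs (expect lam f) <= expect lam g.
Proof.
move=> G fg.
have E : exp_bounded f.
  by apply: exp_bounded_le G => k; apply: Rle_trans (fg k) _; exact: Rle_abs.
rewrite /expect.
have X : ex_series (fun k => Rabs (pois lam k * f k)).
  apply: ex_series_ext (ex_expect (exp_bounded_abs E)) => k.
  by rewrite Rabs_mult (Rabs_pos_eq (pois _ _)) //; exact: pois_ge0.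
apply: Rle_trans (Series_Rabs _ X) _; apply: Series_le; last exact: ex_expect.
move=> k; split; first exact: Rabs_pos.
rewrite Rabs_mult Rabs_pos_eq; last exact: pois_ge0.
by apply: Rmult_le_compat_l => //; exact: pois_ge0.
Qed.

Lemma expect_le f g : exp_bounded f -> exp_bounded g -> (forall k, f k <= g k) ->
  expect lam f <= expect lam g.
Proof.
move=> F G fg.
have : 0 <= expect lam (fun k => g k - f k).
  apply: Rle_trans (Rabs_pos (expect lam (fun=> 0))) _.
  apply: expect_abs_le => [|k]; first by apply: exp_bounded_plus => //; exact: exp_bounded_opp.
  by rewrite Rabs_R0; have := fg k; lra.
by rewrite expect_minus //; lra.
Qed.

(** The Chen-Stein identity: [k * pois lam k = lam * pois lam (k-1)], and the term [k = 0]
    vanishes. *)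
Lemma poisson_stein f : exp_bounded f ->
  expect lam (fun k => (INR k - lam) * f k) =
  lam * expect lam (fun k => f k.+1 - f k).
Proof.
move=> F.
have F1 := exp_bounded_shift F.
have FI : exp_bounded (fun k => INR k * f k).
  by apply: exp_bounded_mult => //; exact: exp_bounded_INR.
have FL : exp_bounded (fun k => lam * f k).
  by apply: exp_bounded_mult => //; exact: exp_bounded_const.
rewrite (expect_ext (g := fun k => INR k * f k - lam * f k)); last by move=> k; ring.
rewrite !expect_minus // expect_scal Rmult_minus_distr_l; congr (_ - _).
rewrite -expect_scal /expect Series_incr_1; last exact: ex_expect.
rewrite [INR 0]/= Rmult_0_l Rmult_0_r Rplus_0_l; apply: Series_ext => k.
rewrite /pois fact_simpl mult_INR S_INR -tech_pow_Rmult.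
field; split; first exact: INR_fact_neq_0.
by have := pos_INR k; lra.
Qed.

End Expect.

(** * Real inequalities *)

Lemma exp_le x y : x <= y -> exp x <= exp y.
Proof. by case=> [/exp_increasing/Rlt_le//|->]; exact: Rle_refl. Qed.

Lemma mvt_abs (f f' : R -> R) (x h M : R) :
  (forall y, is_derive f y (f' y)) ->
  (forall y, Rabs (y - x) <= Rabs h -> Rabs (f' y) <= M) ->
  Rabs (f (x + h) - f x) <= M * Rabs h.
Proof.
move=> df bM.
have [|y _|y [Hy ->]] := @MVT_gen f x (x + h) f'.
- by move=> y _; exact: df.
- by apply: derivable_continuous_pt; exists (f' y); apply/is_derive_Reals; exact: df.
rewrite (_ : x + h - x = h); last ring.
rewrite Rabs_mult; apply: Rmult_le_compat_r; first exact: Rabs_pos.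
apply: bM; move: Hy; rewrite /Rmin /Rmax.
by case: Rle_dec => _ Hy; rewrite /Rabs; case: Rcase_abs => ?; case: Rcase_abs => ?; lra.
Qed.

(** The mean value theorem is applied to [f] minus its linear part and then to [f']; this gives [M]
    in place of the sharp [M / 2]. *)
Lemma taylor1_abs (f f' f'' : R -> R) (x h M : R) :
  (forall y, is_derive f y (f' y)) -> (forall y, is_derive f' y (f'' y)) ->
  (forall y, Rabs (f'' y) <= M) ->
  Rabs (f (x + h) - f x - h * f' x) <= M * h ^ 2.
Proof.
move=> df df' bM.
have M0 : 0 <= M by apply: Rle_trans (bM 0); exact: Rabs_pos.
have H := @mvt_abs (fun y => f y - y * f' x) (fun y => f' y - f' x) x h (M * Rabs h).
have -> : f (x + h) - f x - h * f' x =
  (f (x + h) - (x + h) * f' x) - (f x - x * f' x) by ring.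
have -> : M * h ^ 2 = M * Rabs h * Rabs h by rewrite -(pow2_abs h); ring.
apply: H => [y|y Hy].
  apply: is_derive_minus => //; auto_derive => //; ring.
have -> : y = x + (y - x) by ring.
apply: Rle_trans (@mvt_abs f' f'' x (y - x) M df' _) _ => //.
exact: Rmult_le_compat_l.
Qed.

(** A quadratic remainder bound can be averaged term by term, so this criterion replaces a theorem
    on differentiating under the sum. *)
Lemma is_derive_quadratic (f : R -> R) (x l C : R) :
  (forall h, Rabs (f (x + h) - f x - h * l) <= C * h ^ 2) -> is_derive f x l.
Proof.
move=> H; apply/is_derive_Reals => eps eps0.
have C0 : 0 <= C by have := Rabs_pos (f (x + 1) - f x - 1 * l); have := H 1; lra.
have d0 : 0 < eps / (C + 1) by apply: Rdiv_lt_0_compat; lra.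
exists (mkposreal _ d0) => h h0 /= hd.
have -> : (f (x + h) - f x) / h - l = (f (x + h) - f x - h * l) / h by field.
have ah : 0 < Rabs h by exact: Rabs_pos_lt.
rewrite Rabs_div //; apply/Rlt_div_l => //.
apply: Rle_lt_trans (H h) _; rewrite -pow2_abs.
have : (C + 1) * Rabs h < eps.
  by have := (Rlt_div_r (Rabs h) eps (C + 1)); lra.
nra.
Qed.

(** The right-hand side is the square of [exp (u / 2)], the left-hand side that of [1 + u / 2]. *)
Lemma exp_ge_quadratic u : 0 <= u -> 1 + u + u ^ 2 / 4 <= exp u.
Proof.
move=> u0; have -> : exp u = exp (u / 2) * exp (u / 2) by rewrite -exp_plus; congr exp; field.
have := exp_ineq1_le (u / 2); nra.
Qed.

Lemma exp_neg_le u c : c <= exp u -> c * exp (- u) <= 1.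
Proof.
move=> cu; have e0 := exp_pos (- u).
have <- : exp u * exp (- u) = 1 by rewrite -exp_plus Rplus_opp_r exp_0.
by apply: Rmult_le_compat_r; lra.
Qed.

Lemma exp_neg_le1 u : 0 <= u -> exp (- u) <= 1.
Proof. by move=> u0; rewrite -exp_0; apply: exp_le; lra. Qed.

(** For [f x = x exp (- (t x)^2)], the function fed to the Stein identity, this compares the unit
    difference of [f] with [f']. The second derivative is [t] times a cubic Hermite polynomial in
    [t x] times a Gaussian. *)
Lemma hermite_taylor t x :
  Rabs ((x + 1) * exp (- (t * (x + 1)) ^ 2) - x * exp (- (t * x) ^ 2)
        - (1 - 2 * (t * x) ^ 2) * exp (- (t * x) ^ 2)) <= 6 * Rabs t.
Proof.
have := @taylor1_abs (fun x => x * exp (- (t * x) ^ 2))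
  (fun x => (1 - 2 * (t * x) ^ 2) * exp (- (t * x) ^ 2))
  (fun x => t * (4 * (t * x) ^ 3 - 6 * (t * x)) * exp (- (t * x) ^ 2)) x 1 (6 * Rabs t).
rewrite !Rmult_1_l pow1 Rmult_1_r; apply => y.
- by auto_derive => //=; ring.
- by auto_derive => //=; ring.
move: (t * y) => s; rewrite !Rabs_mult.
have -> : 6 * Rabs t = Rabs t * 6 by ring.
rewrite Rmult_assoc; apply: Rmult_le_compat_l; first exact: Rabs_pos.
rewrite (Rabs_pos_eq (exp _)); last exact/Rlt_le/exp_pos.
have H : Rabs (4 * s ^ 3 - 6 * s) / 6 <= exp (s ^ 2).
  have s2 : 0 <= s ^ 2 by nra.
  apply: Rle_trans (exp_ge_quadratic s2).
  have -> : 4 * s ^ 3 - 6 * s = s * (4 * s ^ 2 - 6) by ring.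
  rewrite Rabs_mult -(pow2_abs s).
  have : Rabs (4 * Rabs s ^ 2 - 6) <= 4 * Rabs s ^ 2 + 6.
    by apply: Rabs_le; have := Rabs_pos s; nra.
  have := Rabs_pos s; move: (Rabs s) => a a0 Ha.
  have : a * Rabs (4 * a ^ 2 - 6) <= a * (4 * a ^ 2 + 6) by apply: Rmult_le_compat_l.
  (* Certificate: [6 + 6 a^2 + 3/2 a^4 - 4 a^3 - 6 a = 3/2 a^2 (a - 4/3)^2 + 10/3 (a - 9/10)^2 +
     33/10]. *)
  have : 0 <= 3 / 2 * a ^ 2 * (a - 4 / 3) ^ 2.
    by apply: Rmult_le_pos; [nra|exact: pow2_ge_0].
  have : 0 <= (a - 9 / 10) ^ 2 by exact: pow2_ge_0.
  nra.
have := exp_neg_le H; lra.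
Qed.

(** The error keeps the factor [D]: for [D = (k - lam)^2] it then averages to a multiple of the
    variance [lam]. *)
Lemma gauss_taylor D t h : 0 <= D ->
  Rabs (exp (- ((t + h) ^ 2 * D)) - exp (- (t ^ 2 * D))
        - h * (- (2 * t) * (D * exp (- (t ^ 2 * D))))) <= 6 * D * h ^ 2.
Proof.
move=> D0.
apply: (@taylor1_abs (fun t => exp (- (t ^ 2 * D)))
  (fun t => - (2 * t) * (D * exp (- (t ^ 2 * D))))
  (fun t => (4 * (t ^ 2 * D) - 2) * D * exp (- (t ^ 2 * D)))) => y.
- by auto_derive => //=; ring.
- by auto_derive => //=; ring.
have y2 : 0 <= y ^ 2 * D by apply: Rmult_le_pos => //; exact: pow2_ge_0.
move: (y ^ 2 * D) y2 => u u0.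
rewrite !Rabs_mult (Rabs_pos_eq D) // (Rabs_pos_eq (exp _)); last exact/Rlt_le/exp_pos.
have E : Rabs (4 * u - 2) <= 4 * (1 + u) by apply: Rabs_le; lra.
have := exp_neg_le (exp_ineq1_le u).
have e0 := exp_pos (- u).
have := Rmult_le_compat_r _ _ _ (Rlt_le _ _ e0) E => H1 H2.
have : Rabs (4 * u - 2) * exp (- u) <= 6 by lra.
nra.
Qed.

Lemma exp_neg_diff u v : 0 <= u -> 0 <= v ->
  Rabs (exp (- u) - exp (- v)) <= Rabs (u - v).
Proof.
wlog uv : u v / u <= v.
  move=> W u0 v0; case: (Rle_dec u v) => uv; first exact: W.
  by rewrite Rabs_minus_sym (Rabs_minus_sym u); apply: W => //; lra.
move=> u0 v0; rewrite (Rabs_left1 (u - v)); last lra.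
have H1 : exp (- v) <= exp (- u) by apply: exp_le; lra.
rewrite Rabs_pos_eq; last lra.
have -> : exp (- v) = exp (- u) * exp (u - v) by rewrite -exp_plus; congr exp; ring.
have := exp_ineq1_le (u - v); have := exp_neg_le1 u0; have := exp_pos (- u).
nra.
Qed.

Lemma ln_1p_le x : -1 < x -> ln (1 + x) <= x.
Proof.
move=> x1; have := exp_ineq1_le x => H.
by rewrite -{2}(ln_exp x); apply: ln_le; lra.
Qed.

(** The function inside has derivative [- y^2 / (1 + y)], and [1 + y >= 1/2] on the range
    considered. *)
Lemma ln_1p_cubic x : Rabs x <= 1 / 2 ->
  Rabs (x - ln (1 + x) - x ^ 2 / 2) <= 2 * Rabs x ^ 3.
Proof.
move=> x12.
have H : forall y, Rabs y <= 1 / 2 ->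
   is_derive (fun y => y - ln (1 + y) - y ^ 2 / 2) y (- y ^ 2 / (1 + y)).
  move=> y /Rabs_le_between Hy; auto_derive; first lra.
  by field; lra.
have [|y Hy|y [Hy]] := @MVT_gen (fun y => y - ln (1 + y) - y ^ 2 / 2) 0 x (fun y => - y ^ 2 / (1 + y)).
- move=> y Hy; apply: H; apply: Rle_trans x12; move: Hy.
  by rewrite /Rmin /Rmax; case: Rle_dec => ? ?; rewrite /Rabs; case: Rcase_abs; case: Rcase_abs; lra.
- apply: derivable_continuous_pt; exists (- y ^ 2 / (1 + y)); apply/is_derive_Reals.
  apply: H; apply: Rle_trans x12; move: Hy.
  by rewrite /Rmin /Rmax; case: Rle_dec => ? ?; rewrite /Rabs; case: Rcase_abs; case: Rcase_abs; lra.
rewrite Rplus_0_r ln_1 => E.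
have -> : x - ln (1 + x) - x ^ 2 / 2 = - y ^ 2 / (1 + y) * (x - 0) by rewrite -E; field.
have yx : Rabs y <= Rabs x.
  move: Hy.
  by rewrite /Rmin /Rmax; case: Rle_dec => ? ?; rewrite /Rabs; case: Rcase_abs; case: Rcase_abs; lra.
have y1 : 1 / 2 <= 1 + y.
  have : Rabs y <= 1 / 2 by lra.
  by move/Rabs_le_between; lra.
rewrite Rminus_0_r Rabs_mult.
have -> : 2 * Rabs x ^ 3 = 2 * Rabs x ^ 2 * Rabs x by ring.
apply: Rmult_le_compat_r; first exact: Rabs_pos.
rewrite Rabs_div; last lra.
rewrite Rabs_Ropp -RPow_abs (Rabs_pos_eq (1 + y)); last lra.
apply/Rle_div_l; first lra.
have := Rabs_pos y; nra.
Qed.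

(** The constant 8 serves large [x]: for [|x| > 1/2] one has [8 |x|^3 >= 1], while both exponentials
    lie in (0,1]. This is what makes a tail estimate unnecessary. *)
Lemma exp_ln_gauss N x : 1 <= N -> -1 < x ->
  Rabs (exp (- (N * (x - ln (1 + x)))) - exp (- (N * x ^ 2 / 2)))
  <= 8 * N * Rabs x ^ 3.
Proof.
move=> N1 x1.
have u0 : 0 <= N * (x - ln (1 + x)).
  by apply: Rmult_le_pos; [lra|have := ln_1p_le x1; lra].
have v0 : 0 <= N * x ^ 2 / 2 by have := pow2_ge_0 x; nra.
have x3 : 0 <= Rabs x ^ 3 by apply: pow_le; exact: Rabs_pos.
case: (Rle_dec (Rabs x) (1 / 2)) => x2.
  apply: Rle_trans (exp_neg_diff u0 v0) _.
  have -> : N * (x - ln (1 + x)) - N * x ^ 2 / 2 = N * (x - ln (1 + x) - x ^ 2 / 2) by field.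
  rewrite Rabs_mult Rabs_pos_eq; last lra.
  have := ln_1p_cubic x2; nra.
have H : 1 <= 8 * Rabs x ^ 3.
  have -> : 8 * Rabs x ^ 3 = (2 * Rabs x) ^ 3 by ring.
  by apply: pow_R1_Rle; lra.
apply: Rle_trans (_ : 1 <= _); last nra.
apply: Rabs_le.
have := exp_neg_le1 u0; have := exp_neg_le1 v0.
have := exp_pos (- (N * (x - ln (1 + x)))); have := exp_pos (- (N * x ^ 2 / 2)); lra.
Qed.

(** * Gaussian approximation of the Poisson law *)

Section Gauss.
Variable lam : R.
Hypothesis lam0 : 0 < lam.
Let d (k : nat) := INR k - lam.

Let dS k : d k.+1 = d k + 1.
Proof. by rewrite /d S_INR; ring. Qed.

Let exp_bounded_d : exp_bounded d.
Proof. exact: exp_bounded_plus exp_bounded_INR (exp_bounded_const _). Qed.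

Lemma exp_bounded_dpow j : exp_bounded (fun k => d k ^ j).
Proof.
by elim: j => [|j IH]; [exact: exp_bounded_const|exact: exp_bounded_mult].
Qed.

Lemma exp_bounded_scal a f : exp_bounded f -> exp_bounded (fun k => a * f k).
Proof. by move=> F; apply: exp_bounded_mult => //; exact: exp_bounded_const. Qed.

Lemma stein_pow j :
  expect lam (fun k => d k ^ j.+1) =
  lam * expect lam (fun k => (d k + 1) ^ j - d k ^ j).
Proof.
rewrite -[LHS]/(expect lam (fun k => (INR k - lam) * d k ^ j)).
rewrite poisson_stein //; last exact: exp_bounded_dpow.
by congr (_ * _); apply: expect_ext => k; rewrite dS.
Qed.

Lemma expect_d1 : expect lam (fun k => d k ^ 1) = 0.
Proof.
rewrite stein_pow (expect_ext _ (g := fun=> 0)) ?expect_const //; first ring.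
by move=> k /=; ring.
Qed.

Lemma expect_d2 : expect lam (fun k => d k ^ 2) = lam.
Proof.
rewrite stein_pow (expect_ext _ (g := fun=> 1)) ?expect_const //; first ring.
by move=> k /=; ring.
Qed.

Lemma expect_d4 : expect lam (fun k => d k ^ 4) = lam * (3 * lam + 1).
Proof.
have d3 : expect lam (fun k => d k ^ 3) = lam.
  rewrite stein_pow (expect_ext _ (g := fun k => 2 * d k ^ 1 + 1)).
    rewrite expect_plus //; first by rewrite expect_scal expect_d1 expect_const //; ring.
      exact/exp_bounded_scal/exp_bounded_dpow.
    exact: exp_bounded_const.
  by move=> k /=; ring.
rewrite stein_pow (expect_ext _ (g := fun k => 3 * d k ^ 2 + (3 * d k ^ 1 + 1))).
  have E1 : exp_bounded (fun k => 3 * d k ^ 1) by exact/exp_bounded_scal/exp_bounded_dpow.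
  rewrite !expect_plus //; first by rewrite !expect_scal expect_d1 expect_d2 expect_const //; ring.
  - exact: exp_bounded_const.
  - exact/exp_bounded_scal/exp_bounded_dpow.
  - by apply: exp_bounded_plus => //; exact: exp_bounded_const.
by move=> k /=; ring.
Qed.

Lemma expect_abs_d3 : 1 <= lam ->
  expect lam (fun k => Rabs (d k) ^ 3) <= 3 * lam * sqrt lam.
Proof.
move=> lam1; have q0 : 0 < sqrt lam by exact: sqrt_lt_R0.
have q2 : sqrt lam * sqrt lam = lam by apply: sqrt_sqrt; lra.
(* The odd absolute moment lies between even ones: [t^2 (sqrt lam - t)^2 >= 0], balanced at the
   standard deviation [sqrt lam]. *)
apply: Rle_trans (_ : _ <= expect lam (fun k => sqrt lam / 2 * d k ^ 2 + / (2 * sqrt lam) * d k ^ 4)) _.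
  apply: expect_le => //.
  - by apply: exp_bounded_le (exp_bounded_dpow 3) => k; rewrite RPow_abs Rabs_Rabsolu; exact: Rle_refl.
  - by apply: exp_bounded_plus; exact/exp_bounded_scal/exp_bounded_dpow.
  move=> k; rewrite -(pow2_abs (d k)) (_ : d k ^ 4 = Rabs (d k) ^ 4); last first.
    by have := pow2_abs (d k) => E; rewrite -[LHS]/(d k ^ (2 * 2)) -[RHS]/(Rabs (d k) ^ (2 * 2)) !pow_mult E.
  move: (Rabs _) (Rabs_pos (d k)) => t t0.
  have : 0 <= t ^ 2 * (sqrt lam - t) ^ 2 / (2 * sqrt lam).
    apply: Rdiv_le_0_compat; last lra.
    by apply: Rmult_le_pos; exact: pow2_ge_0.
  have -> : t ^ 2 * (sqrt lam - t) ^ 2 / (2 * sqrt lam) =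
     sqrt lam / 2 * t ^ 2 + / (2 * sqrt lam) * t ^ 4 - t ^ 3 by field; lra.
  lra.
rewrite expect_plus //; try exact/exp_bounded_scal/exp_bounded_dpow.
rewrite !expect_scal expect_d2 expect_d4.
have -> : / (2 * sqrt lam) * (lam * (3 * lam + 1)) = sqrt lam / 2 * (3 * lam + 1).
  by rewrite -{2}q2; field; lra.
nra.
Qed.

Let phi t := expect lam (fun k => exp (- (t ^ 2 * d k ^ 2))).
Let psi t := expect lam (fun k => d k ^ 2 * exp (- (t ^ 2 * d k ^ 2))).

Let exp_bounded_gauss t : exp_bounded (fun k => exp (- (t ^ 2 * d k ^ 2))).
Proof.
apply: (@exp_bounded_bounded 1) => k; rewrite Rabs_pos_eq; last exact/Rlt_le/exp_pos.
by apply: exp_neg_le1; apply: Rmult_le_pos; exact: pow2_ge_0.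
Qed.

Let exp_bounded_gauss2 t : exp_bounded (fun k => d k ^ 2 * exp (- (t ^ 2 * d k ^ 2))).
Proof. by apply: exp_bounded_mult => //; exact: exp_bounded_dpow. Qed.

Lemma is_derive_phi t : is_derive phi t (- (2 * t) * psi t).
Proof.
apply: (@is_derive_quadratic _ _ _ (6 * lam)) => h.
rewrite -Rmult_assoc /phi /psi -expect_scal -!expect_minus //; first last.
- exact: exp_bounded_scal.
- by apply: exp_bounded_plus => //; exact: exp_bounded_opp.
have -> : 6 * lam * h ^ 2 = expect lam (fun k => 6 * h ^ 2 * d k ^ 2).
  by rewrite expect_scal expect_d2; ring.
apply: expect_abs_le => //; first exact/exp_bounded_scal/exp_bounded_dpow.
move=> k; have := gauss_taylor t h (pow2_ge_0 (d k)).
by congr (Rabs _ <= _); ring.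
Qed.

(** With [f x = x exp (- t^2 x^2)], the Stein identity turns [psi t] into [lam] times the mean
    difference of [f]. Replacing this difference by [f'] gives [lam (phi t - 2 t^2 psi t)]. *)
Lemma stein_gauss t :
  Rabs (lam * phi t - (1 + 2 * lam * t ^ 2) * psi t) <= 6 * lam * Rabs t.
Proof.
have -> : (1 + 2 * lam * t ^ 2) * psi t = psi t + lam * (2 * t ^ 2 * psi t) by ring.
have Epsi : psi t = expect lam (fun k => (INR k - lam) * (d k * exp (- (t ^ 2 * d k ^ 2)))).
  by apply: expect_ext => k; rewrite -/(d k) /=; ring.
rewrite {1}Epsi poisson_stein //; last by apply: exp_bounded_mult.
set S := expect lam (fun k => _ - _).
have -> : lam * phi t - (lam * S + lam * (2 * t ^ 2 * psi t)) =
  - lam * (S - (phi t - 2 * t ^ 2 * psi t)) by ring.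
rewrite Rabs_mult Rabs_Ropp Rabs_pos_eq; last lra.
have -> : 6 * lam * Rabs t = lam * (6 * Rabs t) by ring.
apply: Rmult_le_compat_l; first lra.
have E1 : exp_bounded (fun k => 2 * t ^ 2 * (d k ^ 2 * exp (- (t ^ 2 * d k ^ 2)))) by exact: exp_bounded_scal.
have E2 : exp_bounded (fun k => d k * exp (- (t ^ 2 * d k ^ 2))) by exact: exp_bounded_mult.
rewrite /phi /psi /S -expect_scal -!expect_minus //; first last.
- by apply: exp_bounded_plus => //; exact: exp_bounded_opp.
- apply: exp_bounded_plus; last exact: exp_bounded_opp.
  exact: (exp_bounded_shift E2).
rewrite -[X in _ <= X](expect_const lam).
apply: expect_abs_le => //; first exact: exp_bounded_const.
move=> k; rewrite dS; have := hermite_taylor t (d k).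
rewrite !Rpow_mult_distr; congr (Rabs _ <= _); ring.
Qed.

(* A Poisson variable replaced by a Gaussian [N(lam, lam)]: the Stein identity gives
   [phi' = - 2 t psi] and [(1 + 2 lam t^2) psi ~ lam phi], that is
   [(phi * sqrt (1 + 2 lam t^2))' ~ 0]. *)
Lemma expect_gauss t :
  Rabs (phi t * sqrt (1 + 2 * lam * t ^ 2) - 1) <= 12 * sqrt lam * t ^ 2.
Proof.
have P y : 1 <= 1 + 2 * lam * y ^ 2 by have := pow2_ge_0 y; nra.
have := @mvt_abs (fun y => phi y * sqrt (1 + 2 * lam * y ^ 2))
  (fun y => 2 * y / sqrt (1 + 2 * lam * y ^ 2) * (lam * phi y - (1 + 2 * lam * y ^ 2) * psi y))
  0 t (12 * sqrt lam * Rabs t).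
rewrite Rplus_0_l pow_i; last exact/ltP.
rewrite Rmult_0_r Rplus_0_r sqrt_1 Rmult_1_r.
have -> : phi 0 = 1.
  rewrite -(expect_one lam); apply: expect_ext => k.
  by rewrite pow_i ?Rmult_0_l ?Ropp_0 ?exp_0 //; exact/ltP.
have -> : 12 * sqrt lam * t ^ 2 = 12 * sqrt lam * Rabs t * Rabs t by rewrite -pow2_abs; ring.
apply => [y|y]; have Py := P y; have s0 : 0 < sqrt (1 + 2 * lam * y ^ 2) by (apply: sqrt_lt_R0; lra).
  evar_last.
    apply: is_derive_mult; first exact: is_derive_phi; last by move=> *; exact: Rmult_comm.
    apply: is_derive_sqrt; last lra.
    by auto_derive => //; reflexivity.
  rewrite /plus /mult /=.
  have -> : sqrt (1 + 2 * lam * (y * (y * 1))) = sqrt (1 + 2 * lam * y ^ 2) by [].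
  have s2 : sqrt (1 + 2 * lam * y ^ 2) * sqrt (1 + 2 * lam * y ^ 2) = 1 + 2 * lam * (y * (y * 1)) by apply: sqrt_sqrt; lra.
  by move: (sqrt _) s0 s2 => s s0 <-; field; lra.
rewrite Rminus_0_r => yt.
rewrite Rabs_mult Rabs_div; last lra.
rewrite (Rabs_pos_eq (sqrt _)); last lra.
have H := stein_gauss y.
(* The root in the denominator absorbs one factor [sqrt lam * |y|], so the derivative is bounded by
   [12 sqrt lam |y|] instead of [12 lam y^2]. *)
have sy : sqrt lam * Rabs y <= sqrt (1 + 2 * lam * y ^ 2).
  rewrite -(sqrt_Rsqr_abs y) -sqrt_mult; [|lra|exact: Rle_0_sqr].
  by apply: sqrt_le_1_alt; rewrite Rsqr_pow2; have := pow2_ge_0 y; nra.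
have q0 : 0 < sqrt lam by exact: sqrt_lt_R0.
have q2 : sqrt lam * sqrt lam = lam by apply: sqrt_sqrt; lra.
rewrite Rabs_mult (Rabs_pos_eq 2); last lra.
have y0 := Rabs_pos y.
apply: Rle_trans (_ : _ <= 2 * Rabs y / sqrt (1 + 2 * lam * y ^ 2) * (6 * lam * Rabs y)) _.
  by apply: Rmult_le_compat_l => //; apply: Rdiv_le_0_compat; lra.
have -> : 2 * Rabs y / sqrt (1 + 2 * lam * y ^ 2) * (6 * lam * Rabs y) =
  12 * lam * (Rabs y * Rabs y) / sqrt (1 + 2 * lam * y ^ 2) by field; lra.
apply/Rle_div_l; first lra.
apply: Rle_trans (_ : _ <= 12 * sqrt lam * Rabs y * (sqrt lam * Rabs y)) _.
  by rewrite -{1}q2; right; ring.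
apply: Rle_trans (_ : _ <= 12 * sqrt lam * Rabs y * sqrt (1 + 2 * lam * y ^ 2)) _.
  by apply: Rmult_le_compat_l => //; apply: Rmult_le_pos; lra.
apply: Rmult_le_compat_r; first lra.
by apply: Rmult_le_compat_l; lra.
Qed.

(** The Gaussian estimate is used at [t^2 = N b^2 / 2] and gives the first error. The second is the
    cubic error [8 N b^3], times the third moment bound [3 lam sqrt lam], times the normalizing
    root. *)
Lemma expect_exp_ln N b : 1 <= lam -> 1 <= N -> 0 <= b -> b * lam < 1 ->
  Rabs (expect lam (fun k => exp (- (N * (b * d k - ln (1 + b * d k)))))
        * sqrt (1 + lam * N * b ^ 2) - 1)
  <= 6 * sqrt lam * N * b ^ 2
     + 24 * N * b ^ 3 * lam * sqrt lam * sqrt (1 + lam * N * b ^ 2).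
Proof.
move=> lam1 N1 b0 blam.
have t0 : 0 <= N * b ^ 2 / 2 by have := pow2_ge_0 b; nra.
have t2 : sqrt (N * b ^ 2 / 2) ^ 2 = N * b ^ 2 / 2 by rewrite pow2_sqrt.
have := expect_gauss (sqrt (N * b ^ 2 / 2)); rewrite t2.
have -> : 2 * lam * (N * b ^ 2 / 2) = lam * N * b ^ 2 by field.
have -> : 12 * sqrt lam * (N * b ^ 2 / 2) = 6 * sqrt lam * N * b ^ 2 by field.
set s := sqrt (1 + _); have s0 : 0 <= s by exact: sqrt_pos.
set p := phi _; set q := expect _ _ => H.
(* Since [d k >= - lam], the hypothesis [b * lam < 1] keeps every logarithm inside its domain. *)
have x1 k : -1 < b * d k by have := pos_INR k; rewrite /d; nra.
have Eq : exp_bounded (fun k => exp (- (N * (b * d k - ln (1 + b * d k))))).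
  apply: (@exp_bounded_bounded 1) => k; rewrite Rabs_pos_eq; last exact/Rlt_le/exp_pos.
  by apply: exp_neg_le1; apply: Rmult_le_pos; [lra|have := ln_1p_le (x1 k); lra].
have qp : Rabs (q - p) <= 24 * N * b ^ 3 * lam * sqrt lam.
  rewrite /q /p /phi t2 -expect_minus //; last first.
    by have := exp_bounded_gauss (sqrt (N * b ^ 2 / 2)); rewrite t2.
  apply: Rle_trans (_ : expect lam (fun k => 8 * N * b ^ 3 * Rabs (d k) ^ 3) <= _).
    apply: expect_abs_le => //.
      apply: exp_bounded_scal; apply: exp_bounded_le (exp_bounded_dpow 3) => k.
      by rewrite RPow_abs Rabs_Rabsolu; exact: Rle_refl.
    move=> k; have := exp_ln_gauss N1 (x1 k).
    rewrite Rabs_mult (Rabs_pos_eq b) //.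
    have -> : N * b ^ 2 / 2 * d k ^ 2 = N * (b * d k) ^ 2 / 2 by field.
    by have -> : 8 * N * (b * Rabs (d k)) ^ 3 = 8 * N * b ^ 3 * Rabs (d k) ^ 3 by ring.
  rewrite expect_scal.
  have b3 : 0 <= 8 * N * b ^ 3 by apply: Rmult_le_pos; [lra|exact: pow_le].
  by have := Rmult_le_compat_l _ _ _ b3 (expect_abs_d3 lam1); lra.
have -> : q * s - 1 = (p * s - 1) + (q - p) * s by ring.
apply: Rle_trans (Rabs_triang _ _) _; apply: Rplus_le_compat => //.
by rewrite Rabs_mult (Rabs_pos_eq s) //; exact: Rmult_le_compat_r.
Qed.

End Gauss.

(** * The saddle point *)

Lemma exp_INR_mult (k : nat) x : exp (INR k * x) = exp x ^ k.
Proof.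
elim: k => [|k IH]; first by rewrite /= Rmult_0_l exp_0.
by rewrite S_INR Rmult_plus_distr_r Rmult_1_l exp_plus IH /= Rmult_comm.
Qed.

Lemma INR_ge1 (n : nat) : (0 < n)%N -> 1 <= INR n.
Proof. by move=> n0; apply: (le_INR 1); apply/leP. Qed.

Definition saddle_mean (m n : nat) (r : R) :=
  let lam := exp (INR m * r) / INR m in
  let b := INR m * r / INR n in
  expect lam (fun k => exp (- (INR n * (b * (INR k - lam) - ln (1 + b * (INR k - lam)))))).

(* The parameter [lam = exp (m r) / m] makes the terms linear in [k - lam] cancel. *)
Lemma T_saddle_mean (m c n : nat) (r : R) :
  (0 < m)%N -> (0 < c)%N -> (0 < n)%N -> 0 < r ->
  r * (exp (INR m * r) + INR c) = INR n ->
  let lam := exp (INR m * r) / INR m in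
  INR (T c m n) * exp (/ INR m) =
  exp (lam - INR m * r * lam + INR n * ln (INR n / r)) * saddle_mean m n r.
Proof.
move=> m0 c0 n0 r0 E lam.
have M1 := INR_ge1 m0; have C1 := INR_ge1 c0; have N1 := INR_ge1 n0.
rewrite -(is_series_unique _ _ (@dobinski_formula m c n m0)) /saddle_mean -/lam /expect -Series_scal_l.
apply: Series_ext => k; have k0 := pos_INR k.
have nr0 : 0 < INR n / r by apply: Rdiv_lt_0_compat; lra.
(* By the saddle equation [n / r] is the value of [m k + c] at [k = lam], so [1 + b (k - lam)] is
   the ratio of [m k + c] to that value. *)
have nr : INR n / r = INR m * lam + INR c by rewrite -E /lam; field; lra.
have mk0 : 0 < INR m * INR k + INR c by nra.
have -> : 1 + INR m * r / INR n * (INR k - lam) = (INR m * INR k + INR c) / (INR n / r).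
  by rewrite (_ : INR c = INR n / r - INR m * lam); [field|]; lra.
rewrite (ln_div _ (INR n / r)) // /pois.
have -> : lam ^ k = exp (INR k * (INR m * r)) * (/ INR m) ^ k.
  by rewrite exp_INR_mult -Rpow_mult_distr.
have -> : (INR m * INR k + INR c) ^ n = exp (INR n * ln (INR m * INR k + INR c)).
  by rewrite exp_INR_mult exp_ln.
set L1 := ln _; set L2 := ln _.
have -> : INR n * L1 = (lam - INR m * r * lam + INR n * L2) + (- lam) + INR k * (INR m * r)
  + - (INR n * (INR m * r / INR n * (INR k - lam) - (L1 - L2))) by field; lra.
by rewrite !exp_plus /Rdiv; ring.
Qed.

(** An exact identity. In the exponent [2 c r], one [c r] comes from [- m r lam = - n + c r]; the
    other approximates [n ln (1 + c e^(- m r))], and their difference stays as a correction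
    factor. *)
Lemma T_ratio (m c n : nat) (r : R) :
  (0 < m)%N -> (0 < c)%N -> (0 < n)%N -> 0 < r ->
  r * (exp (INR m * r) + INR c) = INR n ->
  INR (T c m n) /
    (/ sqrt (INR m * r + 1) *
     exp (INR m * INR n * r - INR n + INR n / (INR m * r)
          + 2 * INR c * r - (1 + INR c) / INR m)) =
  exp (INR n * ln (1 + INR c * exp (- (INR m * r))) - INR c * r) *
  (saddle_mean m n r * sqrt (1 + INR m * r)).
Proof.
move=> m0 c0 n0 r0 E.
have M1 := INR_ge1 m0; have C1 := INR_ge1 c0; have N1 := INR_ge1 n0.
have := T_saddle_mean m0 c0 n0 r0 E; set lam := _ / _ => /= TE.
have e0 := exp_pos (INR m * r).
have -> : INR (T c m n) = exp (- / INR m) * (INR (T c m n) * exp (/ INR m)).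
  by rewrite (Rmult_comm (INR (T _ _ _))) -Rmult_assoc -exp_plus Rplus_opp_l exp_0 Rmult_1_l.
rewrite {}TE.
have s0 : 0 < sqrt (INR m * r + 1) by apply: sqrt_lt_R0; nra.
have -> : INR n / r = exp (INR m * r) * (1 + INR c * exp (- (INR m * r))).
  by rewrite -E exp_Ropp; field; lra.
rewrite ln_mult //; last by have := exp_pos (- (INR m * r)); nra.
rewrite ln_exp; set y := ln _.
have lamE : lam = INR n / (INR m * r) - INR c / INR m.
  by rewrite /lam -E; field; lra.
set D := (X in _ / (_ * exp X)).
have DE : - / INR m + (lam - INR m * r * lam + INR n * (INR m * r + y)) =
  (INR n * y - INR c * r) + D by rewrite /D lamE; field; lra.
have := exp_plus (- / INR m) (lam - INR m * r * lam + INR n * (INR m * r + y)).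
rewrite DE exp_plus => X.
rewrite -Rmult_assoc -X [1 + _]Rplus_comm.
by field; split; [lra|exact/Rgt_not_eq/exp_pos].
Qed.

(** Through the fourth root, [ln x <= 4 x^(1/4)], hence [ln^2 x <= 16 sqrt x]; the hypothesis says
    [16 A <= sqrt x]. *)
Lemma ln_sq_le x A : 0 <= A -> 1 <= x -> 256 * A ^ 2 <= x -> A * ln x ^ 2 <= x.
Proof.
move=> A0 x1 Ax.
have s1 : 1 <= sqrt x by rewrite -sqrt_1; apply: sqrt_le_1_alt.
have q1 : 1 <= sqrt (sqrt x) by rewrite -{1}sqrt_1; apply: sqrt_le_1_alt.
have s2 : sqrt x * sqrt x = x by apply: sqrt_sqrt; lra.
have q2 : sqrt (sqrt x) * sqrt (sqrt x) = sqrt x by apply: sqrt_sqrt; lra.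
have L : ln x = 4 * ln (sqrt (sqrt x)).
  rewrite -{1}s2 -{1 2}q2 !ln_mult; try nra; lra.
have := @ln_1p_le (sqrt (sqrt x) - 1).
rewrite (_ : 1 + _ = sqrt (sqrt x)); last ring.
move=> H; have {}H : ln (sqrt (sqrt x)) <= sqrt (sqrt x) by have := H ltac:(lra); lra.
have l0 : 0 <= ln (sqrt (sqrt x)) by rewrite -ln_1; apply: ln_le; lra.
have L2 : ln x ^ 2 <= 16 * sqrt x by rewrite L; nra.
have As : 16 * A <= sqrt x.
  have -> : 16 * A = sqrt ((16 * A) ^ 2) by rewrite sqrt_pow2; lra.
  by apply: sqrt_le_1_alt; nra.
have := Rmult_le_compat_l _ _ _ A0 L2; nra.
Qed.

Lemma exp_le_linear x : 0 <= x <= 1 -> 1 <= exp x <= 1 + 3 * x.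
Proof.
move=> [x0 x1]; have := exp_ineq1_le x; have := exp_ineq1_le (- x).
have := exp_plus x (- x); rewrite Rplus_opp_r exp_0.
have := exp_le_3; have : exp x <= exp 1 by exact: exp_le.
have := exp_pos x; nra.
Qed.

(** With [y = c / e] the quantity is [r e ((1 + y) ln (1 + y) - y)], and
    [y <= (1 + y) ln (1 + y) <= y + y^2]. *)
Lemma saddle_correction r e c n : 0 < r -> 0 < e -> 0 <= c -> r * (e + c) = n ->
  0 <= n * ln (1 + c * / e) - c * r <= c ^ 2 * r / e.
Proof.
move=> r0 e0 c0 <-.
have ie : 0 < / e by exact: Rinv_0_lt_compat.
set y := c * / e; have y0 : 0 <= y by exact: (Rmult_le_pos _ _ c0 (Rlt_le _ _ ie)).
have -> : c = e * y by rewrite /y; field; lra.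
have -> : r * (e + e * y) * ln (1 + y) - e * y * r = (r * e) * ((1 + y) * ln (1 + y) - y) by ring.
have -> : (e * y) ^ 2 * r / e = (r * e) * y ^ 2 by field; lra.
have re : 0 < r * e by nra.
have H1 := @ln_1p_le y ltac:(lra).
have H2 : y / (1 + y) <= ln (1 + y).
  have yi : 0 < / (1 + y) by apply: Rinv_0_lt_compat; lra.
  (* The upper bound for the logarithm, taken at [1 / (1 + y)], is the lower bound wanted at
     [1 + y]. *)
  have := @ln_1p_le (/ (1 + y) - 1) ltac:(lra).
  rewrite (_ : 1 + _ = / (1 + y)); last ring.
  rewrite ln_Rinv; last lra.
  have -> : y / (1 + y) = 1 - / (1 + y) by field; lra.
  lra.
have H3 : y <= (1 + y) * ln (1 + y).
  have := Rmult_le_compat_l (1 + y) _ _ ltac:(lra) H2.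
  by rewrite (_ : (1 + y) * (y / (1 + y)) = y) //; field; lra.
split; first by apply: Rmult_le_pos; lra.
by apply: Rmult_le_compat_l; nra.
Qed.

Lemma Rpower_7_2 x : 0 < x -> Rpower x (7 / 2) = x ^ 3 * sqrt x.
Proof.
move=> x0; have -> : 7 / 2 = INR 3 + / 2 by rewrite /=; field.
by rewrite Rpower_plus Rpower_pow // Rpower_sqrt.
Qed.

Section Saddle.
Variables (m c n : nat) (r : R).
Hypotheses (m0 : (0 < m)%N) (c0 : (0 < c)%N) (n0 : (0 < n)%N) (r0 : 0 < r).
Hypothesis E : r * (exp (INR m * r) + INR c) = INR n.
(** The two largeness conditions on [n]: the first forces [r >= 1] and [ln n >= 1], the second makes
    [c r] at most half of [n], [lam >= 1], and the corrections at most 1. *)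
Hypothesis exp_m_le : exp (INR m) + INR c <= INR n.
Hypothesis ln_sq_small : 2 * (INR c ^ 2 + INR m) * ln (INR n) ^ 2 <= INR n.

Let M1 := INR_ge1 m0.
Let N1 := INR_ge1 n0.
Let C1 := INR_ge1 c0.
Let e0 := exp_pos (INR m * r).

Lemma saddle_ln_ge1 : 1 <= ln (INR n).
Proof.
rewrite -(ln_exp 1); apply: ln_le; first exact: exp_pos.
have := @exp_le 1 (INR m) M1; lra.
Qed.
Let L1 := saddle_ln_ge1.

Lemma saddle_ge1 : 1 <= r.
Proof.
case: (Rle_dec 1 r) => // /Rnot_le_lt r1.
have : exp (INR m * r) <= exp (INR m) by apply: exp_le; nra.
nra.
Qed.
Let r1 := saddle_ge1.

Lemma exp_saddle_le : exp (INR m * r) <= INR n.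
Proof. nra. Qed.

Lemma saddle_le_ln : INR m * r <= ln (INR n).
Proof. by rewrite -{1}(ln_exp (INR m * r)); apply: ln_le => //; exact: exp_saddle_le. Qed.
Let mrL := saddle_le_ln.

Let rL : r <= ln (INR n).
Proof. nra. Qed.

Lemma exp_saddle_ge : INR n <= 2 * (r * exp (INR m * r)).
Proof.
have : 2 * INR c * ln (INR n) <= INR n.
  apply: Rle_trans ln_sq_small.
  have : INR c * ln (INR n) <= INR c ^ 2 * ln (INR n) ^ 2.
    rewrite -Rpow_mult_distr; have : 1 <= INR c * ln (INR n) by nra.
    by move: (INR c * _) => x x1; nra.
  have : 0 <= INR m * ln (INR n) ^ 2 by apply: Rmult_le_pos; nra.
  nra.
have : INR c * r <= INR c * ln (INR n) by apply: Rmult_le_compat_l; lra.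
lra.
Qed.

Lemma saddle_lam_ge1 : 1 <= exp (INR m * r) / INR m.
Proof.
apply/Rle_div_r; first lra; rewrite Rmult_1_l.
have H : 2 * (INR m * r) <= 2 * (r * exp (INR m * r)).
  apply: Rle_trans exp_saddle_ge; apply: Rle_trans ln_sq_small.
  have : INR m * r <= INR m * ln (INR n) ^ 2 by apply: Rmult_le_compat_l; nra.
  have : 0 <= INR c ^ 2 * ln (INR n) ^ 2 by apply: Rmult_le_pos; exact: pow2_ge_0.
  nra.
have : r * (exp (INR m * r) - INR m) >= 0 by lra.
nra.
Qed.

(** The factor [sqrt (1 + lam n b^2)] that the Gaussian step produces; the theorem has
    [sqrt (1 + m r)] in its place. *)
Let s0 := sqrt (1 + INR m * r ^ 2 * exp (INR m * r) / INR n).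

(** The inputs are [lam <= n], [m r <= ln n] and [s0 <= 2 sqrt (ln n)]; the constant is
    [54 = 6 + 24 * 2]. *)
Lemma saddle_mean_bound :
  Rabs (saddle_mean m n r * s0 - 1)
  <= 54 * Rpower (ln (INR n)) (7 / 2) / sqrt (INR n).
Proof.
set lam := exp (INR m * r) / INR m; set b := INR m * r / INR n.
have lam1 : 1 <= lam := saddle_lam_ge1.
have lamn : lam <= INR n.
  apply: Rle_trans exp_saddle_le; apply/Rle_div_l; first lra.
  by rewrite -{1}(Rmult_1_r (exp _)); apply: Rmult_le_compat_l; lra.
have b0 : 0 <= b by apply: Rdiv_le_0_compat; nra.
have blam : b * lam < 1.
  have -> : b * lam = (r * exp (INR m * r)) / INR n by rewrite /b /lam; field; lra.
  by apply/Rlt_div_l; nra.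
have := @expect_exp_ln lam ltac:(lra) (INR n) b lam1 N1 b0 blam.
have -> : 1 + lam * INR n * b ^ 2 = 1 + INR m * r ^ 2 * exp (INR m * r) / INR n.
  by rewrite /lam /b; field; lra.
rewrite -/s0 -[expect _ _]/(saddle_mean m n r) => H.
apply: Rle_trans H _.
have sL : s0 <= 2 * sqrt (ln (INR n)).
  have -> : 2 = sqrt (2 ^ 2) by rewrite sqrt_pow2 //; lra.
  rewrite -sqrt_mult; [|nra|lra]; apply: sqrt_le_1_alt.
  have : INR m * r ^ 2 * exp (INR m * r) / INR n <= INR m * r.
    apply/Rle_div_l; first lra.
    have : r * exp (INR m * r) <= INR n by nra.
    have -> : INR m * r ^ 2 * exp (INR m * r) = INR m * r * (r * exp (INR m * r)) by ring.
    by apply: Rmult_le_compat_l; nra.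
  nra.
have s0' : 0 <= s0 := sqrt_pos _.
rewrite Rpower_7_2; last lra.
move: L1 mrL rL sL; set L := ln (INR n); set l := sqrt L => L1' mrL' rL' sL.
have l1 : 1 <= l by rewrite -sqrt_1; apply: sqrt_le_1_alt.
set w := sqrt (INR n); have w0 : 0 < w by apply: sqrt_lt_R0; lra.
have w2 : w * w = INR n by apply: sqrt_sqrt; lra.
have qw : sqrt lam <= w by exact: sqrt_le_1_alt.
have q0 := sqrt_pos lam.
have z0 : 0 <= INR m * r by nra.
have H1 : sqrt lam * INR n * b ^ 2 <= L ^ 2 / w.
  have -> : sqrt lam * INR n * b ^ 2 = sqrt lam * (INR m * r) ^ 2 / (w * w).
    by rewrite w2 /b; field; lra.
  have -> : L ^ 2 / w = w * L ^ 2 / (w * w) by field; lra.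
  apply: Rmult_le_compat_r; first by apply/Rlt_le/Rinv_0_lt_compat; nra.
  by apply: Rmult_le_compat => //; [exact: pow2_ge_0|apply: pow_incr].
have H2 : INR n * b ^ 3 * lam * sqrt lam * s0 <= 2 * (L ^ 3 * l / w).
  have -> : INR n * b ^ 3 * lam * sqrt lam * s0 =
     (INR m * r) ^ 3 * (lam * (sqrt lam * s0)) / (INR n * INR n).
    by rewrite /b; field; lra.
  have -> : 2 * (L ^ 3 * l / w) = L ^ 3 * (INR n * (w * (2 * l))) / (INR n * INR n).
    by rewrite -w2; field; lra.
  apply: Rmult_le_compat_r; first by apply/Rlt_le/Rinv_0_lt_compat; nra.
  apply: Rmult_le_compat; [exact: pow_le|by do 2 (apply: Rmult_le_pos; try lra)|exact: pow_incr|].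
  apply: Rmult_le_compat; [lra|exact: Rmult_le_pos|lra|].
  exact: Rmult_le_compat.
have H3 : L ^ 2 / w <= L ^ 3 * l / w.
  apply: Rmult_le_compat_r; first by apply/Rlt_le/Rinv_0_lt_compat.
  have : L ^ 2 * 1 <= L ^ 2 * (L * l) by apply: Rmult_le_compat_l; nra.
  by move=> H; rewrite /= in H *; lra.
lra.
Qed.

(** By the saddle equation [1 + m r] exceeds the square of [s0] by exactly [m r * c r / n], and
    [s0 >= 1] makes this a relative error. *)
Lemma saddle_sqrt_ratio :
  s0 <= sqrt (1 + INR m * r) <= s0 * (1 + INR c * ln (INR n) ^ 2 / INR n).
Proof.
have E1 : 1 + INR m * r = 1 + INR m * r ^ 2 * exp (INR m * r) / INR n + INR m * r * (INR c * r) / INR n.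
  by rewrite -E; field; nra.
have z0 : 0 <= INR m * r ^ 2 * exp (INR m * r) / INR n.
  by apply: Rdiv_le_0_compat; [apply: Rmult_le_pos; nra|lra].
have in0 : 0 < / INR n by apply: Rinv_0_lt_compat; lra.
have mr0 : 0 <= INR m * r by nra.
have cr0 : 0 <= INR c * r by nra.
have y0 : 0 <= INR m * r * (INR c * r) / INR n.
  by apply: Rmult_le_pos; [exact: Rmult_le_pos|lra].
have yL : INR m * r * (INR c * r) / INR n <= INR c * ln (INR n) ^ 2 / INR n.
  apply: Rmult_le_compat_r; first lra.
  have -> : INR c * ln (INR n) ^ 2 = ln (INR n) * (INR c * ln (INR n)) by ring.
  by apply: Rmult_le_compat; nra.
split; first by apply: sqrt_le_1_alt; lra.
rewrite /s0 E1.
have key z y v : 0 <= z -> 0 <= y -> y <= v ->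
    sqrt (1 + z + y) <= sqrt (1 + z) * (1 + v).
  move=> z1 y1 yv; rewrite -{1}(sqrt_pow2 (1 + v)); last lra.
  by rewrite -sqrt_mult; [apply: sqrt_le_1_alt; nra|lra|nra].
exact: key.
Qed.

Lemma saddle_error :
  Rabs (exp (INR n * ln (1 + INR c * exp (- (INR m * r))) - INR c * r) *
    (saddle_mean m n r * sqrt (1 + INR m * r)) - 1)
  <= (432 + 12 * INR c ^ 2 + INR c) * Rpower (ln (INR n)) (7 / 2) / sqrt (INR n).
Proof.
have := saddle_correction r0 e0 (pos_INR c) E; rewrite -exp_Ropp.
set dl := _ - INR c * r => -[dl0 dl1].
have in0 : 0 < / INR n by apply: Rinv_0_lt_compat; lra.
have dl2 : dl <= 2 * INR c ^ 2 * (ln (INR n) ^ 2 / INR n).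
  apply: Rle_trans dl1 _; apply/Rle_div_l => //.
  have := exp_saddle_ge => H.
  have : r * INR n <= 2 * ln (INR n) ^ 2 * exp (INR m * r).
    have : r * INR n <= 2 * r ^ 2 * exp (INR m * r).
      by rewrite (_ : 2 * r ^ 2 * _ = r * (2 * (r * exp (INR m * r)))); [apply: Rmult_le_compat_l; lra|ring].
    have : r ^ 2 * exp (INR m * r) <= ln (INR n) ^ 2 * exp (INR m * r).
      by apply: Rmult_le_compat_r; [lra|apply: pow_incr; lra].
    lra.
  move=> {}H.
  have -> : 2 * INR c ^ 2 * (ln (INR n) ^ 2 / INR n) * exp (INR m * r) =
     INR c ^ 2 * (2 * ln (INR n) ^ 2 * exp (INR m * r) / INR n) by field; lra.
  rewrite Rmult_assoc; apply: Rmult_le_compat_l; first exact: pow2_ge_0.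
  by apply/Rle_div_r; lra.
set X := saddle_mean m n r * s0.
have [k1 k2] := saddle_sqrt_ratio.
have s0p : 1 <= s0.
  rewrite -sqrt_1; apply: sqrt_le_1_alt.
  have : 0 <= INR m * r ^ 2 * exp (INR m * r) / INR n; last lra.
  by apply: Rdiv_le_0_compat; [apply: Rmult_le_pos; nra|lra].
set kp := sqrt (1 + INR m * r) / s0.
have -> : saddle_mean m n r * sqrt (1 + INR m * r) = kp * X by rewrite /kp /X; field; lra.
set u := ln (INR n) ^ 2 / INR n in dl2 *.
have u0 : 0 <= u by apply: Rmult_le_pos; [exact: pow2_ge_0|lra].
have cu : 2 * INR c ^ 2 * u <= 1.
  rewrite /u -Rmult_assoc; apply/Rle_div_l; first lra.
  apply: Rle_trans (_ : _ <= 2 * (INR c ^ 2 + INR m) * ln (INR n) ^ 2) _; last by rewrite Rmult_1_l.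
  by apply: Rmult_le_compat_r; [exact: pow2_ge_0|lra].
have kp1 : 1 <= kp by apply/Rle_div_r; lra.
have kp2 : kp <= 1 + INR c * u.
  apply/Rle_div_l; first lra.
  move: k2; rewrite (_ : INR c * ln (INR n) ^ 2 / INR n = INR c * u); last by rewrite /u /Rdiv; ring.
  lra.
have [d1 d2] := @exp_le_linear dl ltac:(lra).
have := saddle_mean_bound; rewrite -/X.
set P := Rpower _ _; set w := sqrt (INR n) => HX.
have uP : u <= P / w.
  have w1 : 1 <= w by rewrite -sqrt_1; apply: sqrt_le_1_alt.
  have w2 : w * w = INR n by apply: sqrt_sqrt; lra.
  have PL : ln (INR n) ^ 2 <= P.
    rewrite /P Rpower_7_2; last lra.
    have l1 : 1 <= sqrt (ln (INR n)) by rewrite -sqrt_1; apply: sqrt_le_1_alt.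
    have : ln (INR n) ^ 2 * 1 <= ln (INR n) ^ 2 * (ln (INR n) * sqrt (ln (INR n))).
      by apply: Rmult_le_compat_l; nra.
    by move=> H; rewrite /= in H *; lra.
  rewrite (_ : u = ln (INR n) ^ 2 * / (w * w)); last by rewrite w2.
  apply: Rmult_le_compat => //.
  - exact: pow2_ge_0.
  - by rewrite w2; lra.
  by apply: Rinv_le_contravar; nra.
have {}HX : Rabs (X - 1) <= 54 * (P / w) by move: HX; rewrite /Rdiv !Rmult_assoc.
have -> : (432 + 12 * INR c ^ 2 + INR c) * P / w = (432 + 12 * INR c ^ 2 + INR c) * (P / w) by rewrite /Rdiv; ring.
move: (exp dl) (P / w) d1 d2 uP HX => ed F d1 d2 uP HX.
have cu0 : 0 <= INR c * u by nra.
have cu1 : INR c * u <= 1 by nra.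
(* From [ed <= 1 + 6 c^2 u] and [kp <= 1 + c u]; the cross term is at most [6 c^2 u] because
   [c u <= 1]. *)
have edkp : 1 <= ed * kp <= 1 + (12 * INR c ^ 2 + INR c) * u.
  split; first nra.
  have : ed * kp <= (1 + 6 * INR c ^ 2 * u) * (1 + INR c * u) by apply: Rmult_le_compat; lra.
  have : 6 * INR c ^ 2 * u * (INR c * u) <= 6 * INR c ^ 2 * u * 1.
    by apply: Rmult_le_compat_l => //; nra.
  lra.
(* This bound times the 54 of [saddle_mean_bound] is the constant 432. *)
have edkp8 : ed * kp <= 8.
  have : ed * kp <= 4 * 2 by apply: Rmult_le_compat; lra.
  lra.
have -> : ed * (kp * X) - 1 = ed * kp * (X - 1) + (ed * kp - 1) by ring.
apply: Rle_trans (Rabs_triang _ _) _.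
rewrite Rabs_mult (Rabs_pos_eq (ed * kp)) ?(Rabs_pos_eq (ed * kp - 1)); try lra.
have : ed * kp * Rabs (X - 1) <= 8 * (54 * F).
  by apply: Rmult_le_compat => //; [lra|exact: Rabs_pos].
have : (12 * INR c ^ 2 + INR c) * u <= (12 * INR c ^ 2 + INR c) * F.
  by apply: Rmult_le_compat_l => //; nra.
lra.
Qed.

End Saddle.

Theorem theorem4 (m c : nat) (r : nat -> R) :
  (0 < m)%nat -> (0 < c)%nat ->
  (forall n : nat, (1 <= n)%nat ->
     0 < r n /\ r n * (exp (INR m * r n) + INR c) = INR n) ->
  exists K : R, exists N : nat, 0 < K /\
    forall n : nat, (N <= n)%nat ->
      Rabs (INR (T c m n) /
              (/ sqrt (INR m * r n + 1) *
               exp (INR m * INR n * r n - INR n + INR n / (INR m * r n)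
                    + 2 * INR c * r n - (1 + INR c) / INR m)) - 1)
      <= K * Rpower (ln (INR n)) (7 / 2) / sqrt (INR n).
Proof.
move=> m0 c0 rP; exists (432 + 12 * INR c ^ 2 + INR c).
set A := 2 * (INR c ^ 2 + INR m).
have M1 := INR_ge1 m0; have C1 := INR_ge1 c0.
have A0 : 0 <= A by rewrite /A; nra.
have eM := exp_pos (INR m); have A2 := pow2_ge_0 A; have c2 := pow2_ge_0 (INR c).
(* The threshold yields both largeness conditions: the first two terms give the one on [exp m], the
   last one gives the other through [ln_sq_le]. *)
have [N NA] := INR_unbounded (exp (INR m) + INR c + 256 * A ^ 2).
exists N; split; first lra.
move=> n /leP/le_INR nN.
have n0 : (0 < n)%N by apply/ltP/INR_lt => /=; lra.
have [r0 E] := rP n n0.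
rewrite T_ratio //; apply: saddle_error => //; first lra.
by apply: (@ln_sq_le _ A) => //; lra.
Qed.
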